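(* The class $\mathbf L_C=\langle\mathcal{CPL}(P): P$ is a set not containing proper terms built by $\{\wedge,\neg,\bot\}\rangle$ of classical propositional logics is a logic family.
   Context: Classical propositional logic $\mathcal{CPL}(P)=\langle F_C,M_C,\mathrm{mng}_C,\models_C\rangle$: connectives binary $\wedge$, unary $\neg$, constant $\bot$; atomic formulas $P$; $F_C$ the universe of the term algebra over $P$; models are functions $\mathfrak M:P\to\{0,1\}$, extended to all formulas by $\mathfrak M(\bot)=0$, $\mathfrak M(\neg\phi)=1-\mathfrak M(\phi)$, $\mathfrak M(\phi\wedge\psi)=\mathfrak M(\phi)\cdot\mathfrak M(\psi)$; $\mathrm{mng}_{\mathfrak M}(\phi)=\mathfrak M(\phi)$; $\mathfrak M\models\phi$ iff $\mathfrak M(\phi)=1$. General notions: a logic $\langle F,M,\mathrm{mng},\models\rangle$ has formula algebra $\mathfrak F$ (term algebra over atomic formulas $P$ in the connectives), models $M$, validity $\models$, and meaning homomorphisms $\mathrm{mng}_{\mathfrak M}$; tautological congruence $\sim=\bigcap_{\mathfrak M}\ker(\mathrm{mng}_{\mathfrak M})$; $\mathrm{Alg}_m(\mathcal L)=\{\mathrm{mng}_{\mathfrak M}(\mathfrak F)\}$. A logic family is $\mathbf L=\langle\mathcal L^P:P\in\mathrm{Sig}\rangle$ ($\mathrm{Sig}$ a class of sets) with: (1) $P$ is the set of atomic formulas of $\mathcal L^P$; (2) common connectives; (3) $P\subseteq Q$ implies $\mathcal L^P$ is a reduct of $\mathcal L^Q$ (i.e. $\mathfrak F^P\le\mathfrak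 F^Q$ and there is a surjection $M^Q\to M^P$ preserving meanings and validity of formulas in $F^P$); (4) whenever $P\in\mathrm{Sig}$ is the disjoint union of $P_i\in\mathrm{Sig}$ ($i\in I$), $\sim^P=\bigcap\{\ker h: h$ a homomorphism from $\mathfrak F^P$ into a member of $\mathrm{Alg}_m(\mathcal L^P)$ with $\bigcup_i\sim^{P_i}\subseteq\ker h\}$; (5a) for $P\in\mathrm{Sig}$ and any set $H$ there is $P'\in\mathrm{Sig}$ disjoint from $H$ with $\mathcal L^{P'}$ an isomorphic copy of $\mathcal L^P$ (isomorphism = formula-algebra isomorphism plus bijection of models preserving meanings and validity); (5b) for any nonempty family $P_i\in\mathrm{Sig}$ there are pairwise disjoint $P_i'\in\mathrm{Sig}$ with $\mathcal L^{P_i'}$ isomorphic copies of $\mathcal L^{P_i}$ and $\bigcup P_i'\in\mathrm{Sig}$; (5c) $\mathrm{Sig}$ has a nonempty member. *)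

(* Defs.v *)
From HB Require Import structures.
From mathcomp Require Import all_boot.
From mathcomp Require Import boolp classical_sets functions.

Set Implicit Arguments.
Unset Strict Implicit.
Unset Printing Implicit Defensive.

Local Open Scope classical_set_scope.
Local Open Scope quotient_scope.

(** * The cumulative hierarchy

  A logic family is indexed by a class of sets and its axioms quantify over all
  sets, so "set" has to mean a member of a universe that is itself too large
  to be a set.  We use Aczel's trees modulo extensional equality: a term of
  type [V] is a set in the sense of ZF, and a class of sets is a [set V]. *)

Inductive tree : Type := Node (A : Type) of A -> tree.

Fixpoint teq (x y : tree) : Prop :=
  match x, y with
  | Node A f, Node B g =>
      (forall a, exists b, teq (f a) (g b)) /\ (forall b, exists a, teq (f a) (g b))
  end.

Lemma teq_refl x : teq x x.
Proof. by elim: x => A f IH /=; split=> a; exists a. Qed.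

Lemma teq_sym x y : teq x y -> teq y x.
Proof.
elim: x y => A f IH [B g] /= [fg gf]; split.
  by move=> b; have [a /IH] := gf b; exists a.
by move=> a; have [b /IH] := fg a; exists b.
Qed.

Lemma teq_trans y x z : teq x y -> teq y z -> teq x z.
Proof.
elim: x y z => A f IH [B g] [C h] /= [fg gf] [gh hg]; split.
  move=> a; have [b fgab] := fg a; have [c ghbc] := gh b.
  by exists c; apply: IH ghbc.
move=> c; have [b ghbc] := hg c; have [a fgab] := gf b.
by exists a; apply: IH ghbc.
Qed.

HB.instance Definition _ := gen_eqMixin tree.
HB.instance Definition _ := gen_choiceMixin tree.

Definition teqb : rel tree := fun x y => `[< teq x y >].

Lemma teqb_refl : reflexive teqb.
Proof. by move=> x; apply/asboolP/teq_refl. Qed.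

Lemma teqb_sym : symmetric teqb.
Proof. by move=> x y; apply/asboolP/asboolP; apply: teq_sym. Qed.

Lemma teqb_trans : transitive teqb.
Proof.
by move=> y x z /asboolP xy /asboolP yz; apply/asboolP; apply: teq_trans yz.
Qed.

Canonical teq_equiv := EquivRel teqb teqb_refl teqb_sym teqb_trans.

Definition V : Type := {eq_quot teq_equiv}.

Definition branching (t : tree) : Type := let: Node A _ := t in A.
Definition subtree (t : tree) : branching t -> tree :=
  match t with Node A f => f end.

Definition vindex (x : V) : Type := branching (repr (x : {eq_quot teq_equiv})).
Definition member (x : V) (a : vindex x) : V :=
  \pi_{eq_quot teq_equiv} (subtree a).

Definition elts (x : V) : set V := range (@member x).

Definition vset (A : Type) (f : A -> V) : V :=
  \pi_{eq_quot teq_equiv} (Node (fun a => repr (f a : {eq_quot teq_equiv}))).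

Lemma pi_teq (t u : tree) :
  \pi_{eq_quot teq_equiv} t = \pi_{eq_quot teq_equiv} u <-> teq t u.
Proof.
split; first by move=> /eqmodP /asboolP.
by move=> tu; apply/eqmodP/asboolP.
Qed.

Lemma repr_teq (t : tree) : teq (repr (\pi_{eq_quot teq_equiv} t)) t.
Proof. by apply/pi_teq; rewrite reprK. Qed.

Lemma elts_pi (t : tree) (x : V) :
  elts (\pi_{eq_quot teq_equiv} t) x <->
  exists a : branching t, x = \pi_{eq_quot teq_equiv} (subtree a).
Proof.
rewrite /elts /member /vindex; move: (repr _) (repr_teq t) => u.
case: u t => [A f] [B g] /= [fg gf]; split.
  by move=> [a _ <-]; have [b fgab] := fg a; exists b; apply/pi_teq.
by move=> [b ->]; have [a fgab] := gf b; exists a => //; apply/pi_teq.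
Qed.

Lemma elts_vset (A : Type) (f : A -> V) : elts (vset f) = range f.
Proof.
rewrite predeqE => x; rewrite elts_pi; split=> /=.
  by move=> [a ->]; exists a => //; rewrite reprK.
by move=> [a _ <-]; exists a; rewrite reprK.
Qed.

Lemma vext (x y : V) : elts x = elts y -> x = y.
Proof.
rewrite -[x](reprK (x : {eq_quot teq_equiv})).
rewrite -[y](reprK (y : {eq_quot teq_equiv})).
move: (repr _) (repr _) => [B g] [A f] fg; apply/pi_teq => /=; split=> [a|b].
  have : elts (\pi_{eq_quot teq_equiv} (Node g)) (\pi_{eq_quot teq_equiv} (f a)).
    by rewrite -fg; apply/elts_pi; exists a.
  by move=> /elts_pi [b /pi_teq]; exists b.
have : elts (\pi_{eq_quot teq_equiv} (Node f)) (\pi_{eq_quot teq_equiv} (g b)).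
  by rewrite fg; apply/elts_pi; exists b.
by move=> /elts_pi [a /pi_teq /teq_sym]; exists a.
Qed.

Lemma elts_ind (K : V -> Prop) :
  (forall x, (forall y, elts x y -> K y) -> K x) -> forall x, K x.
Proof.
move=> IH x; rewrite -[x](reprK (x : {eq_quot teq_equiv})).
by elim: (repr _) => A f IHf; apply: IH => y /elts_pi [a ->]; apply: IHf.
Qed.

Definition vempty : V := vset (fun x : False => match x with end).
Definition upair (x y : V) : V := vset (fun b : bool => if b then x else y).
Definition opair (x y : V) : V := upair (upair x x) (upair x y).

Definition vbigcup (I : V) (P : V -> V) : V :=
  vset (fun k : {i : vindex I & vindex (P (member i))} => member (projT2 k)).

Lemma elts_vempty : elts vempty = set0.
Proof. by rewrite elts_vset predeqE => x; split=> // -[[]]. Qed.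

Lemma elts_upair x y : elts (upair x y) = [set x; y].
Proof.
rewrite elts_vset predeqE => z; split=> /=; first by move=> [[] _ <-]; [left|right].
by case=> ->; [exists true | exists false].
Qed.

Lemma elts_vbigcup I P : elts (vbigcup I P) = \bigcup_(i in elts I) elts (P i).
Proof.
rewrite elts_vset predeqE => x; split=> /=.
  by move=> [[i k] _ <-]; exists (member i); [exists i | exists k].
by move=> [_ [i _ <-] [k _ <-]]; exists (existT _ i k).
Qed.

Lemma upair_inj a x y : upair a x = upair a y -> x = y.
Proof.
move=> /(congr1 elts); rewrite !elts_upair => e.
have : [set a; y] x by rewrite -e; right.
have : [set a; x] y by rewrite e; right.
by move=> [->|->] // [->|].
Qed.

Lemma opair_inj x y x' y' : opair x y = opair x' y' -> x = x' /\ y = y'.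
Proof.
move=> e; suff xx' : x = x'.
  by split=> //; move: e; rewrite xx' => /upair_inj /upair_inj.
have : elts (opair x' y') (upair x x) by rewrite -e elts_upair; left.
rewrite elts_upair => -[] /(congr1 elts); rewrite !elts_upair => {}e.
  have : [set x; x] x' by rewrite e; left.
  by case.
have : [set x; x] x' by rewrite e; left.
by case.
Qed.

(** * Similarity types, algebras and terms *)

(* [symb c] is the set serving as the symbol of the connective [c] in terms. *)
Record simtype := SimType {
  conn : Type;
  arity : conn -> nat;
  symb : conn -> V;
  symb_inj : injective symb }.

(* [alg S T] are the algebras with universe included in [T]; the operations are
   only relevant on the universe. *)
Record alg (S : simtype) (T : Type) := Alg {
  univ : set T;
  op : forall c : conn S, ('I_(arity c) -> T) -> T }.

Definition is_alg (S : simtype) (T : Type) (A : alg S T) : Prop :=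
  forall (c : conn S) (a : 'I_(arity c) -> T),
    (forall i, univ A (a i)) -> univ A (op A a).

Definition subalg (S : simtype) (T : Type) (A B : alg S T) : Prop :=
  [/\ is_alg A, is_alg B, univ A `<=` univ B &
    forall (c : conn S) (a : 'I_(arity c) -> T),
      (forall i, univ A (a i)) -> op A a = op B a].

Definition is_hom (S : simtype) (T U : Type) (A : alg S T) (B : alg S U)
    (h : T -> U) : Prop :=
  (forall x, univ A x -> univ B (h x)) /\
  forall (c : conn S) (a : 'I_(arity c) -> T),
    (forall i, univ A (a i)) -> h (op A a) = op B (fun i => h (a i)).

Definition is_iso (S : simtype) (T U : Type) (A : alg S T) (B : alg S U)
    (h : T -> U) : Prop :=
  is_hom A B h /\ set_bij (univ A) (univ B) h.

(* Used when [h] is a homomorphism from [A] into [B]. *)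
Definition hom_image (S : simtype) (T U : Type) (A : alg S T) (B : alg S U)
    (h : T -> U) : alg S U :=
  Alg (h @` univ A) (@op S U B).

Definition ker (S : simtype) (T U : Type) (A : alg S T) (h : T -> U) : set (T * T) :=
  [set xy | [/\ univ A xy.1, univ A xy.2 & h xy.1 = h xy.2]].

Definition vtuple (n : nat) (a : 'I_n -> V) : V :=
  foldr opair vempty [seq a i | i <- enum 'I_n].

(* The term c(a_0, ..., a_{n-1}) is the tuple <c, a_0, ..., a_{n-1}>. *)
Definition app (S : simtype) (c : conn S) (a : 'I_(arity c) -> V) : V :=
  opair (symb c) (vtuple a).

Definition proper_term (S : simtype) (x : V) : Prop :=
  exists (c : conn S) (a : 'I_(arity c) -> V), x = app a.

Inductive term (S : simtype) (P : V) : V -> Prop :=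
| term_atom x : elts P x -> term S P x
| term_app (c : conn S) (a : 'I_(arity c) -> V) :
    (forall i, term S P (a i)) -> term S P (app a).

(* Absolutely free over [P] as soon as [P] contains no proper term. *)
Definition term_alg (S : simtype) (P : V) : alg S V :=
  Alg (term S P) (@app S).

Lemma vtuple_inj n (a b : 'I_n -> V) : vtuple a = vtuple b -> a = b.
Proof.
move=> e; apply/funext => i.
have : {in enum 'I_n, a =1 b}; last by apply; rewrite mem_enum.
move: e; rewrite /vtuple; elim: (enum 'I_n) => //= j s IH /opair_inj [ab /IH es] k.
by rewrite in_cons => /orP [/eqP ->|/es].
Qed.

Lemma app_inj (S : simtype) (c d : conn S) (a : 'I_(arity c) -> V)
    (b : 'I_(arity d) -> V) :
  app a = app b -> existT (fun c => 'I_(arity c) -> V) c a = existT _ d b.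
Proof.
by move=> /opair_inj [/symb_inj cd]; subst d => /vtuple_inj ->.
Qed.

(** * Logics *)

(* [S] is the similarity type of connectives and [D] a type containing all
   meanings.  [mng_alg M] is the codomain of the homomorphism [mng M]. *)
Record logic (S : simtype) (D : Type) := Logic {
  atoms : V;
  model : Type;
  mng_alg : model -> alg S D;
  mng : model -> V -> D;
  valid : model -> V -> Prop }.

Definition formula_alg (S : simtype) (D : Type) (L : logic S D) : alg S V :=
  term_alg S (atoms L).

Definition formula (S : simtype) (D : Type) (L : logic S D) : set V :=
  univ (formula_alg L).

Record is_logic (S : simtype) (D : Type) (L : logic S D) : Prop := IsLogic {
  atoms_proper : forall x, elts (atoms L) x -> ~ proper_term S x;
  mng_alg_closed : forall M : model L, is_alg (mng_alg M);
  mng_hom : forall M : model L, is_hom (formula_alg L) (mng_alg M) (mng M) }.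

Definition taut_cong (S : simtype) (D : Type) (L : logic S D) : set (V * V) :=
  (formula L `*` formula L) `&`
  \bigcap_(M in [set: model L]) ker (formula_alg L) (mng M).

Definition Alg_m (S : simtype) (D : Type) (L : logic S D) : set (alg S D) :=
  range (fun M : model L => hom_image (formula_alg L) (mng_alg M) (mng M)).

Definition is_reduct (S : simtype) (D : Type) (L K : logic S D) : Prop :=
  subalg (formula_alg L) (formula_alg K) /\
  exists f : model K -> model L,
    (forall N, exists M, f M = N) /\
    forall M phi, formula L phi ->
      mng M phi = mng (f M) phi /\ (valid M phi <-> valid (f M) phi).

Definition logic_iso (S : simtype) (D : Type) (L K : logic S D) : Prop :=
  exists (g : V -> V) (f : model L -> model K),
    [/\ is_iso (formula_alg L) (formula_alg K) g, bijective f &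
      forall M phi, formula L phi ->
        mng (f M) (g phi) = mng M phi /\ (valid (f M) (g phi) <-> valid M phi)].

(** * Logic families *)

Definition disjoint_family (I : V) (P : V -> V) : Prop :=
  forall i j, elts I i -> elts I j -> i <> j ->
    elts (P i) `&` elts (P j) = set0.

(* That the members have common connectives is expressed by their all being
   of type [logic S D] for the same [S].  Families of sets are given by an
   index set [I : V] and a map [V -> V], of which only the values on [I] matter;
   likewise only the values of [L] on [Sig] matter. *)
Record is_logic_family (S : simtype) (D : Type) (Sig : set V)
    (L : V -> logic S D) : Prop := IsLogicFamily {
  family_logic : forall P, Sig P -> is_logic (L P);
  family_atoms : forall P, Sig P -> atoms (L P) = P;
  family_reduct : forall P Q, Sig P -> Sig Q -> elts P `<=` elts Q ->
    is_reduct (L P) (L Q);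
  family_cong : forall (P I : V) (P_ : V -> V),
    Sig P -> (forall i, elts I i -> Sig (P_ i)) ->
    disjoint_family I P_ -> P = vbigcup I P_ ->
    taut_cong (L P) =
      (formula (L P) `*` formula (L P)) `&`
      \bigcap_(h in [set h : V -> D |
          (exists2 B, Alg_m (L P) B & is_hom (formula_alg (L P)) B h) /\
          \bigcup_(i in elts I) taut_cong (L (P_ i)) `<=`
            ker (formula_alg (L P)) h])
        ker (formula_alg (L P)) h;
  family_copy : forall P H : V, Sig P ->
    exists P' : V, [/\ Sig P', elts P' `&` elts H = set0 &
      logic_iso (L P) (L P')];
  family_union : forall (I : V) (P_ : V -> V),
    elts I !=set0 -> (forall i, elts I i -> Sig (P_ i)) ->
    exists P'_ : V -> V,
      [/\ forall i, elts I i -> Sig (P'_ i), disjoint_family I P'_,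
          forall i, elts I i -> logic_iso (L (P_ i)) (L (P'_ i)) &
          Sig (vbigcup I P'_)];
  family_nonempty : exists2 P, Sig P & elts P !=set0 }.

(** * Classical propositional logic *)

Inductive cpl_conn := And | Neg | Bot.

Definition cpl_arity (c : cpl_conn) : nat :=
  match c with And => 2 | Neg => 1 | Bot => 0 end.

Definition cpl_symb (c : cpl_conn) : V :=
  match c with
  | And => vempty
  | Neg => upair vempty vempty
  | Bot => upair (upair vempty vempty) (upair vempty vempty)
  end.

Lemma upair_neq0 x y : upair x y <> vempty.
Proof.
move=> /(congr1 elts); rewrite elts_upair elts_vempty predeqE => /(_ x) [+ _].
by apply; left.
Qed.

Lemma cpl_symb_inj : injective cpl_symb.
Proof.
have neq : upair (upair vempty vempty) (upair vempty vempty) <> upair vempty vempty.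
  move=> /(congr1 elts); rewrite !elts_upair predeqE => /(_ vempty) [_].
  by move=> /(_ (or_introl erefl)) [] /esym /upair_neq0.
move=> [] [] //= e; exfalso; first [exact: (upair_neq0 e)
  | exact: (upair_neq0 (esym e)) | exact: (neq e) | exact: (neq (esym e))].
Qed.

Definition cpl_type : simtype := @SimType cpl_conn cpl_arity cpl_symb cpl_symb_inj.

Definition fbot : V := @app cpl_type Bot (fun _ => vempty).
Definition fneg (phi : V) : V := @app cpl_type Neg (fun _ => phi).
Definition fand (phi psi : V) : V :=
  @app cpl_type And (fun i => if i == ord0 then phi else psi).

Definition two : alg cpl_type bool :=
  @Alg cpl_type bool [set: bool]
    (fun c : cpl_conn =>
       match c return ('I_(cpl_arity c) -> bool) -> bool with
       | And => fun a => a ord0 && a ord_max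
       | Neg => fun a => ~~ a ord0
       | Bot => fun _ => false
       end).

Definition cpl_model (P : V) : Type := {x : V | elts P x} -> bool.

(* The graph of the extension of [M] to formulas, with {0,1} as [bool]; it is
   single-valued if [P] contains no proper term. *)
Inductive cpl_val (P : V) (M : cpl_model P) : V -> bool -> Prop :=
| val_atom (p : {x : V | elts P x}) : cpl_val M (sval p) (M p)
| val_bot : cpl_val M fbot false
| val_neg phi b : cpl_val M phi b -> cpl_val M (fneg phi) (~~ b)
| val_and phi psi b c :
    cpl_val M phi b -> cpl_val M psi c -> cpl_val M (fand phi psi) (b && c).

Definition cpl_mng (P : V) (M : cpl_model P) (phi : V) : bool :=
  `[< cpl_val M phi true >].

Definition CPL (P : V) : logic cpl_type bool :=
  {| atoms := P;
     model := cpl_model P;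
     mng_alg := fun _ => two;
     mng := @cpl_mng P;
     valid := fun M phi => cpl_mng M phi = true |}.

Definition CPL_Sig : set V :=
  [set P | forall x, elts P x -> ~ proper_term cpl_type x].

(* Main.v *)
From mathcomp Require Import all_boot.
From mathcomp Require Import boolp classical_sets functions.
Require Import Defs.

Set Implicit Arguments.
Unset Strict Implicit.
Unset Printing Implicit Defensive.

Local Open Scope classical_set_scope.

(** Atoms are never proper terms, so the term algebra is absolutely free over
  its atoms: truth valuations are exactly the homomorphisms into the
  two-element algebra, and they are determined by their values on the atoms.
  Every meaning algebra is the whole two-element algebra, so the homomorphisms
  in axiom (4) are again valuations; conversely a valuation on a disjoint union
  restricts to valuations on the parts.  Copies are made by tagging atoms with
  ordered pairs whose first component is not a connective symbol, and
  foundation supplies a tag that avoids any given set. *)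

(** * Sets *)

Lemma elts_irrefl (x : V) : ~ elts x x.
Proof. by elim/elts_ind: x => x IH xx; exact: (IH x xx xx). Qed.

Definition vimage (f : V -> V) (P : V) : V :=
  vset (fun a : vindex P => f (member a)).

Lemma elts_vimage f P : elts (vimage f P) = f @` elts P.
Proof.
rewrite elts_vset predeqE => y; split.
  by move=> [a _ <-]; exists (member a) => //; exists a.
by move=> [_ [a _ <-] <-]; exists a.
Qed.

(** The chain [x] in {[x]} in [opair x y] in [H] is undone by two unions, so tagging with a set
    outside the double union of [H] avoids [H]. *)
Lemma opair_fst (H x y : V) : elts H (opair x y) ->
  elts (vbigcup (vbigcup H id) id) x.
Proof.
move=> Hxy; rewrite elts_vbigcup; exists (upair x x); last by rewrite elts_upair; left.
by rewrite elts_vbigcup; exists (opair x y) => //; rewrite /opair elts_upair; left.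
Qed.

Lemma injective_left_inverse (f : V -> V) : injective f -> exists r, cancel f r.
Proof.
move=> finj.
have /choice [r rP] : forall y, exists x, (exists x', f x' = y) -> f x = y.
  move=> y; have [[x fx]|no] := pselect (exists x', f x' = y); first by exists x.
  by exists y.
by exists r => x; apply: finj; apply: rP; exists x.
Qed.

(** * Freeness of the term algebra *)

Section Free.

Variables (S : simtype) (P : V).

Lemma term_alg_closed : is_alg (term_alg S P).
Proof. by move=> c a aP; exact: term_app. Qed.

Lemma hom_eq_on_terms (T : Type) (A : alg S T) (h k : V -> T) :
  is_hom (term_alg S P) A h -> is_hom (term_alg S P) A k ->
  (forall x, elts P x -> h x = k x) ->
  forall x, term S P x -> h x = k x.
Proof.
move=> [_ hop] [_ kop] hk x; elim=> {x} [x /hk //|c a aP IH].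
by rewrite hop // kop //; congr op; apply/funext.
Qed.

Hypothesis Pproper : forall x, elts P x -> ~ proper_term S x.
Variables (T : Type) (A : alg S T) (f : V -> T).

(** Recursion on terms is given as a graph: [term] is a proposition about sets and cannot be
    eliminated into [T]. *)
Inductive ext_graph : V -> T -> Prop :=
| ext_atom x : elts P x -> ext_graph x (f x)
| ext_app (c : conn S) (a : 'I_(arity c) -> V) (b : 'I_(arity c) -> T) :
    (forall i, ext_graph (a i) (b i)) -> ext_graph (app a) (op A b).

Lemma ext_graph_atom x y : elts P x -> ext_graph x y -> y = f x.
Proof. by move=> Px G; case: G Px => // c a b _ /Pproper; case; exists c, a. Qed.

Lemma ext_graph_app (c : conn S) (a : 'I_(arity c) -> V) y :
  ext_graph (app a) y ->
  exists2 b, y = op A b & forall i, ext_graph (a i) (b i).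
Proof.
move=> G; case: {-2}_ y / G (erefl (app a)) => [x Px e|c' a' b G /app_inj e].
  by case: (Pproper Px); exists c, a.
(* [app_inj] equates dependent pairs; stating the goal over the pair lets one rewrite move
   connective and arguments together. *)
pose K (s : {c : conn S & 'I_(arity c) -> V}) :=
  exists2 b' : 'I_(arity (projT1 s)) -> T,
    op A b = op A b' & forall i, ext_graph (projT2 s i) (b' i).
suff : K (existT _ c a) by [].
by rewrite -e; exists b.
Qed.

Lemma ext_graph_unique x : term S P x -> exists! y, ext_graph x y.
Proof.
elim=> {x} [x Px|c a _ IH].
  by exists (f x); split=> [|y /(ext_graph_atom Px) //]; exact: ext_atom.
have /choice [b bP] : forall i, exists y, ext_graph (a i) y /\
    forall y', ext_graph (a i) y' -> y = y'.
  by move=> i; have [y [? ?]] := IH i; exists y.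
exists (op A b); split; first by apply: ext_app => i; case: (bP i).
move=> y /ext_graph_app [b' -> Gb']; congr op; apply/funext => i.
by case: (bP i) => _; apply.
Qed.

(** The graph is total and single-valued on terms, so choice turns it into a function; off the terms
    its values are arbitrary. *)
Lemma hom_extension : is_alg A -> (forall x, elts P x -> univ A (f x)) ->
  exists2 h, is_hom (term_alg S P) A h & forall x, elts P x -> h x = f x.
Proof.
move=> Acl fA.
have /choice [h hP] : forall x, exists y, term S P x -> ext_graph x y.
  move=> x; have [/ext_graph_unique [y [Gy _]]|no] := pselect (term S P x).
    by exists y.
  by exists (f x).
have hf x : elts P x -> h x = f x.
  by move=> Px; apply: ext_graph_atom => //; apply: hP; exact: term_atom.
have hop (c : conn S) (a : 'I_(arity c) -> V) :
    (forall i, term S P (a i)) -> h (app a) = op A (fun i => h (a i)).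
  move=> aP; have [y [_ yu]] := ext_graph_unique (term_app aP).
  rewrite -(yu (h (app a))); last by apply: hP; exact: term_app.
  by apply: yu; apply: ext_app => i; exact: hP.
exists h => //; split=> //= x; elim=> {x} [x Px|c a aP IH].
  by rewrite hf //; exact: fA.
by rewrite hop //; exact: Acl.
Qed.

End Free.

Lemma term_sub (S : simtype) (P Q : V) :
  elts P `<=` elts Q -> term S P `<=` term S Q.
Proof.
move=> PQ x; elim=> {x} [x /PQ|c a _ IH]; [exact: term_atom|exact: term_app].
Qed.

Lemma hom_sub (S : simtype) (T : Type) (A : alg S T) (P Q : V) h :
  elts P `<=` elts Q -> is_hom (term_alg S Q) A h -> is_hom (term_alg S P) A h.
Proof.
move=> PQ [hu hop]; split=> [x /(term_sub PQ) /hu //|c a aP].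
by apply: hop => i; exact: term_sub (aP i).
Qed.

Lemma hom_comp (S : simtype) (T U W : Type) (A : alg S T) (B : alg S U)
    (C : alg S W) (h : T -> U) (k : U -> W) :
  is_hom A B h -> is_hom B C k -> is_hom A C (k \o h).
Proof.
move=> [hu hop] [ku kop]; split=> [x /hu /ku //|c a aA] /=.
by rewrite hop // kop // => i; exact: hu.
Qed.

Lemma hom_id (S : simtype) (T : Type) (A : alg S T) : is_hom A A id.
Proof. by []. Qed.

(** * Valuations *)

Definition model_restr (P : V) (f : V -> bool) : cpl_model P :=
  fun p => f (sval p).
Arguments model_restr : clear implicits.

(** The default [false] off [P] makes models over different atom sets comparable as functions on
    [V]. *)
Definition model_ext (P : V) (M : cpl_model P) (x : V) : bool :=
  if pselect (elts P x) is left Px then M (exist _ x Px) else false.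

Lemma model_ext_atom (P : V) (M : cpl_model P) p : model_ext M (sval p) = M p.
Proof.
case: p => x Px /=; rewrite /model_ext; case: pselect => // Px'.
by congr (M (exist _ x _)); exact: Prop_irrelevance.
Qed.

Lemma model_eqP (P : V) (M N : cpl_model P) :
  (forall x, elts P x -> model_ext M x = model_ext N x) -> M = N.
Proof.
move=> MN; apply/funext => p; rewrite -!model_ext_atom; apply: MN.
exact: (proj2_sig p).
Qed.

Lemma model_ext_restr (P : V) f x : elts P x ->
  model_ext (model_restr P f) x = f x.
Proof. by move=> Px; rewrite (model_ext_atom _ (exist _ x Px)). Qed.

Lemma two_closed : is_alg two.
Proof. by []. Qed.

Section Valuation.

Variables (P : V) (SP : CPL_Sig P).

(** Freeness gives a homomorphism [h] extending [M]. Induction on [cpl_val] and then on terms shows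
    that [cpl_val M] is exactly the graph of [h] on formulas, so [cpl_mng M] agrees with [h]
    there. *)
Lemma cpl_mng_hom_ext (M : cpl_model P) :
  is_hom (term_alg cpl_type P) two (cpl_mng M) /\
  forall x, elts P x -> cpl_mng M x = model_ext M x.
Proof.
have [h [_ hop] hM] := hom_extension SP two_closed (fun x _ => I : univ two (model_ext M x)).
have valh x b : cpl_val M x b -> term cpl_type P x /\ h x = b.
  elim=> {x b} [[x Px]||phi b _ [t <-]|phi psi b c _ [t <-] _ [u <-]].
  - by split; [exact: term_atom|rewrite hM // -model_ext_atom].
  (* [fbot] carries a dummy argument family, which consists of terms vacuously. *)
  - have t (i : 'I_0) : term cpl_type P vempty by case: i.
    by split; [exact: (@term_app cpl_type P Bot)|rewrite (hop Bot)].
  - by split; [exact: (@term_app cpl_type P Neg)|rewrite (hop Neg)].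
  - have tu (i : 'I_2) : term cpl_type P (if i == ord0 then phi else psi).
      by case: ifP.
    by split; [exact: (@term_app cpl_type P And)|rewrite (hop And)].
have hval x : term cpl_type P x -> cpl_val M x (h x).
  elim=> {x} [x Px|c a aP IH].
    by rewrite hM // (model_ext_atom _ (exist _ x Px)); exact: (val_atom M (exist _ x Px)).
  rewrite (hop c a aP); case: c a aP IH => a aP IH.
  (* An index in ['I_2] other than [ord0] is [ord_max], so two values recover [a]. *)
  - have -> : app a = fand (a ord0) (a ord_max).
      congr app; apply/funext => i; case: eqP => [->//|i0]; congr a; apply: val_inj.
      by case: i i0 => -[|[|]] // ? [] ; apply: val_inj.
    exact: val_and.
  - have -> : app a = fneg (a ord0).
      by congr app; apply/funext => i; rewrite ord1.
    exact: val_neg.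
  - have -> : app a = fbot by congr app; apply/funext => -[].
    exact: val_bot.
have mngE x : term cpl_type P x -> cpl_mng M x = h x.
  move=> t; apply/asboolP/idP => [/valh [] //|hx].
  by move: (hval x t); rewrite hx.
split; last by move=> x Px; rewrite mngE ?hM //; exact: term_atom.
split=> // c a aP; rewrite mngE; last exact: term_app.
by rewrite (hop c a aP); congr op; apply/funext => i; rewrite mngE //; exact: aP.
Qed.

Lemma cpl_mng_hom (M : cpl_model P) :
  is_hom (term_alg cpl_type P) two (cpl_mng M).
Proof. by case: (cpl_mng_hom_ext M). Qed.

Lemma cpl_mng_atom (M : cpl_model P) x : elts P x -> cpl_mng M x = model_ext M x.
Proof. by case: (cpl_mng_hom_ext M) => _; apply. Qed.

Lemma hom_is_valuation h : is_hom (term_alg cpl_type P) two h ->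
  forall x, term cpl_type P x -> cpl_mng (model_restr P h) x = h x.
Proof.
move=> hh; apply: hom_eq_on_terms hh _; first exact: cpl_mng_hom.
by move=> x Px; rewrite cpl_mng_atom // model_ext_restr.
Qed.

Lemma CPL_is_logic : is_logic (CPL P).
Proof. by split=> // M; exact: cpl_mng_hom. Qed.

(** Meaning algebras inherit the operations of [two], whose universe is all of [bool]. *)
Lemma Alg_m_hom_two B h : Alg_m (CPL P) B ->
  is_hom (term_alg cpl_type P) B h -> is_hom (term_alg cpl_type P) two h.
Proof. by move=> [M _ <-] [_ hop]; split. Qed.

Lemma CPL_hom_image (M : cpl_model P) :
  exists2 B, Alg_m (CPL P) B & is_hom (term_alg cpl_type P) B (cpl_mng M).
Proof.
exists (hom_image (term_alg cpl_type P) two (cpl_mng M)); first by exists M.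
by have [_ mop] := cpl_mng_hom M; split=> // x tx; exists x.
Qed.

End Valuation.

(** * Restriction to fewer atoms: reducts and the congruence axiom *)

Lemma cpl_mng_restr (P Q : V) (M : cpl_model Q) : CPL_Sig P -> CPL_Sig Q ->
  elts P `<=` elts Q -> forall x, term cpl_type P x ->
  cpl_mng (model_restr P (model_ext M)) x = cpl_mng M x.
Proof.
move=> SP SQ PQ; apply: hom_eq_on_terms; first exact: cpl_mng_hom.
  by apply: hom_sub PQ _; exact: cpl_mng_hom.
by move=> x Px; rewrite !cpl_mng_atom ?model_ext_restr //; exact: PQ.
Qed.

Lemma CPL_reduct (P Q : V) : CPL_Sig P -> CPL_Sig Q -> elts P `<=` elts Q ->
  is_reduct (CPL P) (CPL Q).
Proof.
move=> SP SQ PQ; split.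
  by split=> //; [exact: term_alg_closed|exact: term_alg_closed|exact: term_sub].
exists (fun M => model_restr P (model_ext M)); split.
  (* A preimage of [N] under restriction makes the atoms of [Q] outside [P] false. *)
  move=> N; exists (model_restr Q (model_ext N)); apply: model_eqP => x Px.
  by rewrite !model_ext_restr //; exact: PQ.
by move=> M phi tphi /=; rewrite cpl_mng_restr.
Qed.

Lemma CPL_cong (P I : V) (P_ : V -> V) :
  CPL_Sig P -> (forall i, elts I i -> CPL_Sig (P_ i)) -> P = vbigcup I P_ ->
  taut_cong (CPL P) =
    (formula (CPL P) `*` formula (CPL P)) `&`
    \bigcap_(h in [set h : V -> bool |
        (exists2 B, Alg_m (CPL P) B & is_hom (formula_alg (CPL P)) B h) /\
        \bigcup_(i in elts I) taut_cong (CPL (P_ i)) `<=`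
          ker (formula_alg (CPL P)) h])
      ker (formula_alg (CPL P)) h.
Proof.
move=> SP SPi PE.
have PiP i : elts I i -> elts (P_ i) `<=` elts P.
  by move=> Ii x Pix; rewrite PE elts_vbigcup; exists i.
rewrite predeqE => -[x y]; split=> -[[/= tx ty] xy]; split=> //.
  move=> h [[B AB /(Alg_m_hom_two AB) hh] _]; split=> //=.
  (* Tautological congruence is tested at the model read off from [h] on atoms, whose meaning
     function is [h]. *)
  have [_ _ /=] := xy (model_restr P h) Logic.I.
  by rewrite !(hom_is_valuation SP hh).
(* Conversely [cpl_mng M] is itself an admissible [h]: congruence over a part is tested at the
   restriction of [M] to that part. *)
move=> M _; apply: xy; split; first exact: CPL_hom_image.
move=> [u v] [i Ii [[/= tu tv] /(_ (model_restr (P_ i) (model_ext M)) Logic.I)]].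
have PiPi := PiP i Ii; move=> [_ _ /=]; rewrite !cpl_mng_restr //; try exact: SPi.
by split=> //; exact: term_sub PiPi _ _.
Qed.

(** * Isomorphic copies *)

(** The map [f] and a left inverse [r] extend from atoms to homomorphisms of the term algebras. Both
    composites fix the atoms, hence all terms. *)
Lemma CPL_iso_vimage (f : V -> V) (P : V) : injective f ->
  CPL_Sig P -> CPL_Sig (vimage f P) -> logic_iso (CPL P) (CPL (vimage f P)).
Proof.
move=> /injective_left_inverse [r fK]; set Q := vimage f P => SP SQ.
have fPQ x : elts P x -> elts Q (f x) by move=> Px; rewrite elts_vimage; exists x.
have Q_ind (K : V -> Prop) : (forall x, elts P x -> K (f x)) -> forall y, elts Q y -> K y.
  by move=> Kf y; rewrite elts_vimage => -[x Px <-]; exact: Kf.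
have [g gh gf] := hom_extension SP (@term_alg_closed cpl_type Q)
  (fun x Px => term_atom cpl_type (fPQ x Px)).
have rP y : elts Q y -> term cpl_type P (r y).
  by move: y; apply: Q_ind => x Px; rewrite fK; exact: term_atom.
have [g' g'h g'r] := hom_extension SQ (@term_alg_closed cpl_type P) rP.
have gK x : term cpl_type P x -> g' (g x) = x.
  apply: (hom_eq_on_terms (hom_comp gh g'h) (@hom_id _ _ _)) => {}x Px /=.
  by rewrite gf // g'r ?fK //; exact: fPQ.
have g'K y : term cpl_type Q y -> g (g' y) = y.
  apply: (hom_eq_on_terms (hom_comp g'h gh) (@hom_id _ _ _)); apply: Q_ind => x Px /=.
  by rewrite g'r ?fK ?gf //; exact: fPQ.
(* Models are transported by precomposition with [r], so the truth value of an atom [x] passes to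
   [f x]. *)
exists g, (fun M => model_restr Q (model_ext M \o r)); split.
- split=> //; split=> [x tx|x y /set_mem tx /set_mem ty gxy|y ty].
  + by case: gh => gu _; exact: gu.
  + by rewrite -(gK x tx) gxy gK.
  + by exists (g' y); [case: g'h => gu _; exact: gu|exact: g'K].
- exists (fun N => model_restr P (model_ext N \o f)) => M.
    apply: model_eqP => x Px; have Qfx := fPQ x Px.
    by rewrite model_ext_restr //= model_ext_restr //= fK.
  apply: model_eqP; apply: Q_ind => x Px; have Qfx := fPQ x Px.
  by rewrite model_ext_restr //= fK model_ext_restr.
move=> M phi tphi /=; suff -> : cpl_mng (model_restr Q (model_ext M \o r)) (g phi) =
  cpl_mng M phi by [].
apply: (hom_eq_on_terms (hom_comp gh (cpl_mng_hom SQ _)) (cpl_mng_hom SP M)) tphi.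
move=> x Px /=; have Qfx := fPQ x Px.
by rewrite gf // !cpl_mng_atom // model_ext_restr //= fK.
Qed.

Lemma opair_not_proper_term (u x : V) : (forall c, u <> cpl_symb c) ->
  ~ proper_term cpl_type (opair u x).
Proof. by move=> uc [c [a /opair_inj [/uc]]]. Qed.

Lemma CPL_copy (P H : V) : CPL_Sig P ->
  exists P', [/\ CPL_Sig P', elts P' `&` elts H = set0 & logic_iso (CPL P) (CPL P')].
Proof.
move=> SP.
(* [u] collects the connective symbols and the double union of [H]. As [u] is not its own element,
   it is none of these. *)
pose u := vbigcup (upair (vset cpl_symb) (vbigcup (vbigcup H id) id)) id.
have uE : elts u = range cpl_symb `|` elts (vbigcup (vbigcup H id) id).
  by rewrite [LHS]elts_vbigcup elts_upair bigcup_setU !bigcup_set1 elts_vset.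
have uc c : u <> cpl_symb c.
  by move=> e; apply: (@elts_irrefl u); rewrite {1}uE e; left; exists c.
have SP' : CPL_Sig (vimage (opair u) P).
  by move=> y; rewrite elts_vimage => -[x _ <-]; exact: opair_not_proper_term.
exists (vimage (opair u) P); split=> //; last first.
  by apply: CPL_iso_vimage => // x y /opair_inj [].
rewrite -subset0 elts_vimage => _ [[x _ <-] /opair_fst uH].
by apply: (@elts_irrefl u); rewrite {1}uE; right.
Qed.

Lemma CPL_union (I : V) (P_ : V -> V) : (forall i, elts I i -> CPL_Sig (P_ i)) ->
  exists P'_ : V -> V,
    [/\ forall i, elts I i -> CPL_Sig (P'_ i), disjoint_family I P'_,
        forall i, elts I i -> logic_iso (CPL (P_ i)) (CPL (P'_ i)) &
        CPL_Sig (vbigcup I P'_)].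
Proof.
move=> SP; pose u := vset cpl_symb.
have uc c : u <> cpl_symb c.
  by move=> e; apply: (@elts_irrefl u); rewrite {1}/u elts_vset e; exists c.
(* The outer tag [u] prevents proper terms; the inner tag [i] keeps the copies disjoint even when
   some [P_ i] coincide. *)
pose tag i x := opair u (opair i x).
have SP' i : CPL_Sig (vimage (tag i) (P_ i)).
  by move=> y; rewrite elts_vimage => -[x _ <-]; exact: opair_not_proper_term.
exists (fun i => vimage (tag i) (P_ i)); split=> //.
- move=> i j _ _ ij; rewrite -subset0 !elts_vimage => _ [[x _ <-] [y _]].
  by move=> /opair_inj [_ /opair_inj [/esym]].
- move=> i Ii; apply: CPL_iso_vimage => //; last exact: SP.
  by move=> x y /opair_inj [_ /opair_inj []].
- by move=> x; rewrite elts_vbigcup => -[i _]; exact: SP'.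
Qed.

Lemma CPL_Sig_nonempty : exists2 P, CPL_Sig P & elts P !=set0.
Proof.
(* The only atom is the empty set, which is no proper term because ordered pairs are nonempty. *)
exists (upair vempty vempty); last by exists vempty; rewrite elts_upair; left.
by move=> x; rewrite elts_upair => -[] -> [c [a /esym /upair_neq0]].
Qed.

Theorem theorem5p1 : is_logic_family CPL_Sig CPL.
Proof.
split.
- exact: CPL_is_logic.
- by [].
- exact: CPL_reduct.
- by move=> P I P_ SP SPi _; exact: CPL_cong.
- exact: CPL_copy.
- by move=> I P_ _; exact: CPL_union.
- exact: CPL_Sig_nonempty.
Qed.
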